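(* Let $V=\mathbb{C}^2$ be the natural representation of the infinite dicyclic group $\mathrm{Dic}_\infty\subset SU(2)$. For $k\ge 1$ let $f_k$ be the $k$th dicyclic Jones--Wenzl projector, regarded (via $\bullet\mapsto V$ and the assignment of cap, cup and decorated cup-cap to $\mathrm{ev}$, $\mathrm{coev}$, $e_{\bar 1}$) as an element of $\mathrm{End}_{\mathrm{Dic}_\infty}(V^{\otimes k})$. Then for every $k\ge1$, $f_k$ is the idempotent projecting $V^{\otimes k}$ onto its leading summand $V_k=\mathrm{span}\{v_1^{\otimes k},v_2^{\otimes k}\}$. The same holds for the finite dicyclic group $\mathrm{Dic}_n\subset SU(2)$ in place of $\mathrm{Dic}_\infty$ when $1\le k<n$.
   Context: $\mathrm{Dic}_\infty$ is generated by $x=\begin{pmatrix}0&-1\\1&0\end{pmatrix}$ and $a=\mathrm{diag}(e^{i\theta},e^{-i\theta})$ with $\theta$ a fixed irrational multiple of $\pi$; $\mathrm{Dic}_n$ is generated by $x$ and $\mathrm{diag}(e^{\pi i/n},e^{-\pi i/n})$. Both act on $V=\mathbb{C}^2$ with standard basis $v_1,v_2$. The leading summand of $V^{\otimes k}$ is the multiplicity one simple summand not occurring in any smaller tensor power of $V$; it is the span $V_k$ of $v_1^{\otimes k},v_2^{\otimes k}$. The idempotent projecting onto it is the unique equivariant idempotent with image $V_k$ (with kernel the sum of all other isotypic components). The maps are: $\mathrm{ev}\colon V\otimes V\to\mathbb{C}$ with $v_1\otimes v_1,v_2\otimes v_2\mapsto 0$, $v_1\otimes v_2\mapsto 1$,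 $v_2\otimes v_1\mapsto-1$; $\mathrm{coev}\colon\mathbb{C}\to V\otimes V$ with $1\mapsto v_2\otimes v_1-v_1\otimes v_2$; and $e_{\bar 1}\in\mathrm{End}(V^{\otimes 2})$ killing $v_1\otimes v_1,v_2\otimes v_2$ and sending both $v_1\otimes v_2$ and $v_2\otimes v_1$ to $-(v_1\otimes v_2+v_2\otimes v_1)$. The dicyclic Jones--Wenzl projectors are defined by $f_1=\mathrm{id}$, $f_2=\mathrm{id}+\tfrac12(\mathrm{coev}\circ\mathrm{ev}+e_{\bar 1})$, and for $j\ge2$ $$f_{j+1}=(f_j\otimes\mathrm{id})+(f_j\otimes\mathrm{id})\circ e_j\circ(f_j\otimes\mathrm{id}),\qquad e_j=\mathrm{id}^{\otimes(j-1)}\otimes(\mathrm{coev}\circ\mathrm{ev}).$$ *)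

(* Defs.v *)
(* Complex numbers are R[i] for an arbitrary R : realType. *)
From mathcomp Require Import all_boot all_order all_algebra.
From mathcomp Require Import mxtens complex.
From mathcomp Require Import reals trigo.

Set Implicit Arguments.
Unset Strict Implicit.
Unset Printing Implicit Defensive.

Import Order.TTheory GRing.Theory Num.Theory.

Local Open Scope ring_scope.
Local Open Scope complex_scope.

(* V^{(x) k} is 'cV[R[i]]_(2 ^ k), with the Kronecker product *t as the tensor
   product of vectors and of maps; endomorphisms of V^{(x) k} are matrices
   acting on columns from the left, and g acts on V^{(x) k} by g ^t k. *)
Notation tpow R k := 'cV[R[i]]_(2 ^ k).
Notation tend R k := 'M[R[i]]_(2 ^ k).

Section BasisAndMaps.
Variable R : realType.

Definition v1 : 'cV[R[i]]_2 := delta_mx ord0 ord0.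
Definition v2 : 'cV[R[i]]_2 := delta_mx ord_max ord0.

(* Here (u *t v)^T is the linear form dual to the basis vector u *t v. *)
Definition ev : 'M[R[i]]_(1, 2 * 2) := (v1 *t v2)^T - (v2 *t v1)^T.

Definition coev : 'M[R[i]]_(2 * 2, 1) := v2 *t v1 - v1 *t v2.

Definition e1bar : 'M[R[i]]_(2 * 2) :=
  - (v1 *t v2 + v2 *t v1) *m ((v1 *t v2)^T + (v2 *t v1)^T).

Lemma cupcap_dim m : (2 ^ m * (2 * 2) = 2 ^ m.+2)%N.
Proof. by rewrite !expnSr mulnA. Qed.

(* cupcap m is e_j for j = m + 1, an endomorphism of V^{(x) (j + 1)}. *)
Definition cupcap m : tend R m.+2 :=
  castmx (cupcap_dim m, cupcap_dim m)
    ((1%:M : tend R m) *t (coev *m ev)).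

Definition tens_id k (f : tend R k) : tend R k.+1 :=
  castmx (esym (expnSr 2 k), esym (expnSr 2 k)) (f *t (1%:M : 'M[R[i]]_2)).

(* f_(j+1) as a function of f_j; f_1 and f_2 are given outright, and the
   recursion proper applies to j = m + 2. *)
Definition JW_step j : tend R j -> tend R j.+1 :=
  match j return tend R j -> tend R j.+1 with
  | 0 => fun _ => 1%:M
  | 1 => fun _ => 1%:M + 2^-1 *: (coev *m ev + e1bar)
  | m.+2 => fun f => tens_id f + tens_id f *m cupcap m.+1 *m tens_id f
  end.

(* JW k is f_k for 1 <= k; JW 0 is a junk value. *)
Fixpoint JW k : tend R k := if k is j.+1 then JW_step (JW j) else 1%:M.

End BasisAndMaps.

Section Groups.
Variable R : realType.

Inductive generated (S : 'M[R[i]]_2 -> Prop) : 'M[R[i]]_2 -> Prop :=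
| generated1 : generated S 1%:M
| generated_in g : S g -> generated S g
| generatedM g h : generated S g -> generated S h -> generated S (g *m h)
| generatedV g : generated S g -> generated S (invmx g).

Definition expi (t : R) : R[i] := cos t +i* sin t.

Definition gen_x : 'M[R[i]]_2 :=
  \matrix_(i, j) if (i == ord0) && (j == ord_max) then -1
                 else if (i == ord_max) && (j == ord0) then 1 else 0.

Definition gen_a (t : R) : 'M[R[i]]_2 :=
  diag_mx (\row_j if j == ord0 then expi t else expi (- t)).

Definition dicyclic (t : R) : 'M[R[i]]_2 -> Prop :=
  generated (fun g => g = gen_x \/ g = gen_a t).

Definition Dic_inf (theta : R) := dicyclic theta.
Definition Dic_fin (n : nat) := dicyclic (pi / n%:R).

End Groups.

Arguments Dic_fin R n : clear implicits.

Section Representations.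
Variables (R : realType) (G : 'M[R[i]]_2 -> Prop).

Definition equivariant k (f : tend R k) : Prop :=
  forall g, G g -> f *m g ^t k = g ^t k *m f.

Definition stable k (U : {vspace tpow R k}) : Prop :=
  forall g, G g -> forall u, u \in U -> g ^t k *m u \in U.

Definition simple_sub k (U : {vspace tpow R k}) : Prop :=
  [/\ stable U, U <> 0%VS &
      forall W : {vspace tpow R k},
        stable W -> (W <= U)%VS -> W = 0%VS \/ W = U].

(* The ambient map h matters only through its restriction U -> W. *)
Definition rep_iso j k (U : {vspace tpow R j}) (W : {vspace tpow R k}) : Prop :=
  exists h : 'Hom(tpow R j, tpow R k),
    [/\ {in U &, injective h}, (h @: U)%VS = W &
        forall g, G g -> forall u, u \in U -> h (g ^t j *m u) = g ^t k *m h u].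

(* W is the (possibly infinite) sum of the subspaces satisfying P. *)
Definition is_sum_of k (P : {vspace tpow R k} -> Prop) (W : {vspace tpow R k}) :
    Prop :=
  (forall U, P U -> (U <= W)%VS) /\
  (forall W', (forall U, P U -> (U <= W')%VS) -> (W <= W')%VS).

Definition is_isotypic k (S C : {vspace tpow R k}) : Prop :=
  is_sum_of (fun U => simple_sub U /\ rep_iso U S) C.

(* Complete reducibility is part of the claim: S occurs exactly once in a
   decomposition of V^{(x) k} as a direct sum of simple subrepresentations. *)
Definition multiplicity_one k (S : {vspace tpow R k}) : Prop :=
  exists s : seq {vspace tpow R k},
    [/\ forall U, U \in s -> simple_sub U /\ ~ rep_iso U S,
        directv (S + \sum_(U <- s) U) &
        (S + \sum_(U <- s) U)%VS = fullv].

Definition occurs_in j k (S : {vspace tpow R k}) : Prop :=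
  exists U : {vspace tpow R j}, simple_sub U /\ rep_iso U S.

Definition leading_summand k (S : {vspace tpow R k}) : Prop :=
  [/\ simple_sub S, multiplicity_one S &
      forall j, (j < k)%N -> ~ occurs_in j S].

Definition equiv_idempotent_onto k (S : {vspace tpow R k}) (f : tend R k) :
    Prop :=
  [/\ equivariant f, f *m f = f &
      limg (linfun (mulmx f : tpow R k -> tpow R k)) = S].

Definition projector_onto k (S : {vspace tpow R k}) (f : tend R k) : Prop :=
  [/\ equiv_idempotent_onto S f,
      forall p, equiv_idempotent_onto S p -> p = f &
      is_sum_of
        (fun C => exists T, [/\ simple_sub T, ~ rep_iso T S & is_isotypic T C])
        (lker (linfun (mulmx f : tpow R k -> tpow R k)))].

End Representations.

Definition vec_tpow (R : realType) k (v : 'cV[R[i]]_2) : tpow R k :=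
  castmx (erefl _, exp1n k) (v ^t k).

Definition Vk (R : realType) k : {vspace tpow R k} :=
  <<[:: vec_tpow k (v1 R); vec_tpow k (v2 R)]>>%VS.

(* Main.v *)
(* In the standard basis b_i of V^{(x) k}, i < 2 ^ k read in binary, a acts
   diagonally with eigenvalue z^(k - 2 c) on b_i, where z = e^{i theta} and c is
   the number of ones of i, and x maps b_i to a nonzero multiple of b_{i'}, i'
   being the bitwise complement 2^k - 1 - i.  The recursion shows that f_k is
   the diagonal matrix selecting the first and the last basis vector.  As z^m
   <> 1 for 0 < m <= 2 k, the eigenvalue z^k of a determines (k, i) = (k, 0)
   among all V^{(x) j} with j <= k, so a simple summand is V_k as soon as it
   has an eigenvector for z^k.  The other pairs {b_i, b_{i'}} span subspaces
   that are simple or split into two eigenlines of x, which gives complete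
   reducibility without averaging over the group. *)
Require Import Defs.
From mathcomp Require Import all_boot all_order all_algebra.
From mathcomp Require Import mxtens complex.
From mathcomp Require Import reals trigo.
From mathcomp Require Import boolp ring lra zify.

Set Implicit Arguments.
Unset Strict Implicit.
Unset Printing Implicit Defensive.

Import Order.TTheory GRing.Theory Num.Theory.

Local Open Scope ring_scope.
Local Open Scope complex_scope.

(** * Kronecker powers of vectors and matrices *)

Section KroneckerPowers.
Variable K : comNzRingType.

(** The first Kronecker power is [A] itself; from the second on, the power unfolds to a Kronecker
    product whose leading factor can be peeled off. *)
Lemma ntensmxSr m n (A : 'M[K]_(m, n)) k : (0 < k)%N ->
  forall (i : 'I_(m ^ k.+1)) (j : 'I_(n ^ k.+1))
         (i1 : 'I_m) (j1 : 'I_n) (i2 : 'I_(m ^ k)) (j2 : 'I_(n ^ k)),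
  i = (i1 * m ^ k + i2)%N :> nat -> j = (j1 * n ^ k + j2)%N :> nat ->
  (A ^t k.+1) i j = A i1 j1 * (A ^t k) i2 j2.
Proof.
case: k => // k _ i j i1 j1 i2 j2 ei ej.
have -> : i = mxtens_index (i1, i2) :> 'I_(m * m ^ k.+1) by apply: val_inj.
have -> : j = mxtens_index (j1, j2) :> 'I_(n * n ^ k.+1) by apply: val_inj.
exact: tensmxE.
Qed.

Lemma ntensmxM m n p (A : 'M[K]_(m, n)) (B : 'M[K]_(n, p)) k :
  (A *m B) ^t k = A ^t k *m B ^t k.
Proof.
elim: k => [|[|k] IH]; first by rewrite mul1mx.
  by [].
by rewrite !ntensmxSS IH tensmx_mul.
Qed.

Lemma ntensmx_scalar n (a : K) k : (a%:M : 'M_n) ^t k = (a ^+ k)%:M.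
Proof.
elim: k => [|[|k] IH] //.
rewrite ntensmxSS IH; apply/matrixP => i j.
case: (mxtens_indexP i) => i1 i2; case: (mxtens_indexP j) => j1 j2.
rewrite tensmxE !mxE (can_eq (@mxtens_indexK _ _)) xpair_eqE.
by case: eqP; case: eqP; rewrite /= ?mulr1n ?mulr0n ?mul0r ?mulr0 // (exprS _ k.+1).
Qed.

End KroneckerPowers.

Section Bits.

(** Division by [2 ^ k] splits off the leading binary digit, which indexes the leftmost tensor
    factor. *)
Lemma bit_split k (i : 'I_(2 ^ k.+1)) :
  exists (i1 : 'I_2) (i2 : 'I_(2 ^ k)), i = (i1 * 2 ^ k + i2)%N :> nat.
Proof.
have h1 : (i %/ 2 ^ k < 2)%N by rewrite ltn_divLR ?expn_gt0 // -expnS.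
have h2 : (i %% 2 ^ k < 2 ^ k)%N by rewrite ltn_mod expn_gt0.
by exists (Ordinal h1), (Ordinal h2); rewrite /= -divn_eq.
Qed.

Lemma bit_split_inj k (i1 j1 : 'I_2) (i2 j2 : 'I_(2 ^ k)) :
  (i1 * 2 ^ k + i2 == j1 * 2 ^ k + j2)%N = (i1 == j1) && (i2 == j2).
Proof. by rewrite eq_addl_mul // xpair_eqE. Qed.

End Bits.

(** * Powers of diagonal and antidiagonal matrices and of basis vectors *)

Section Generators.
Variable K : comNzRingType.

(* The eigenvalue at [i] is [z ^+ (k - c i) * w ^+ c i], [c i] being the number
   of ones among the [k] binary digits of [i]. *)
Lemma ntensmx_diag k : exists c : 'I_(2 ^ k) -> nat,
  [/\ forall i, (c i <= k)%N,
      forall i, (c i == 0%N) = (i == 0%N :> nat),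
      forall i, (c i == k) = (i.+1 == 2 ^ k)%N &
      forall z w : K,
      diag_mx (\row_(j < 2) if j == ord0 then z else w) ^t k =
      diag_mx (\row_i (z ^+ (k - c i) * w ^+ c i))].
Proof.
elim: k => [|k [c [c_le c0 ck cE]]].
  exists (fun=> 0%N); split=> [//|[[|i] hi] //|[[|i] hi] //|z w].
  by apply/matrixP => i j; rewrite !mxE !ord1 /= !mulr1n mulr1.
(* The first power is the matrix itself and is checked by hand: a single digit is its own number of
   ones. *)
have [->|k_gt0] := posnP k.
  exists (fun i => i); split=> [[[|[|i]] hi] //|//|[[|[|i]] hi] //|z w].
  apply/matrixP => i j; rewrite !mxE.
  case: i => -[|[|//]] hi; case: j => -[|[|//]] hj;
    rewrite -!val_eqE /= ?mulr0n // ?expr1 ?expr0 ?mulr1 ?mul1r //.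
pose hi (i : 'I_(2 ^ k.+1)) := (i %/ 2 ^ k)%N.
have lo_lt (i : 'I_(2 ^ k.+1)) : (i %% 2 ^ k < 2 ^ k)%N
  by rewrite ltn_mod expn_gt0.
pose lo i := Ordinal (lo_lt i).
have hl (i : 'I_(2 ^ k.+1)) (i1 : 'I_2) (i2 : 'I_(2 ^ k)) :
    i = (i1 * 2 ^ k + i2)%N :> nat -> hi i = i1 /\ lo i = i2.
  move=> e; split; first by rewrite /hi e divnMDl ?expn_gt0 // divn_small ?addn0.
  by apply: val_inj; rewrite /= e modnMDl modn_small.
have pk : (0 < 2 ^ k)%N by rewrite expn_gt0.
exists (fun i => hi i + c (lo i))%N; split => [i|i|i|z w].
- have [i1 [i2 e]] := bit_split i; have [-> ->] := hl _ _ _ e.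
  by have := c_le i2; have := ltn_ord i1; lia.
- have [i1 [i2 e]] := bit_split i; have [-> ->] := hl _ _ _ e.
  by rewrite addn_eq0 c0 e addn_eq0 muln_eq0 (gtn_eqF pk) orbF.
- have [i1 [i2 e]] := bit_split i; have [-> ->] := hl _ _ _ e.
  have := ck i2; have := c_le i2; have := ltn_ord i2; rewrite e expnS.
  case: i1 {e} => -[|[|//]] hi1 /=; rewrite ?mul0n ?mul1n; lia.
- apply/matrixP => i j.
  have [i1 [i2 ei]] := bit_split i; have [j1 [j2 ej]] := bit_split j.
  have [hi1 hi2] := hl _ _ _ ei.
  rewrite (ntensmxSr _ k_gt0 ei ej) cE !mxE hi1 hi2.
  rewrite (_ : (i == j) = (i1 == j1) && (i2 == j2)); last first.
    by rewrite -val_eqE /= ei ej bit_split_inj.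
  have := c_le i2.
  case: (i1 == j1); last by rewrite !mulr0n mul0r.
  case: (i2 == j2); last by rewrite !mulr0n mulr0.
  case: i1 {ei hi1} => -[|[|//]] h1 le; rewrite -!val_eqE /= !mulr1n.
    by rewrite mulrA -exprS subSn.
  by rewrite mulrCA -exprS.
Qed.

(** Each entry is a product of entries of [A] over the digits and vanishes if [i] and [j] agree in
    some digit; [rev_ord] complements all digits. *)
Lemma ntensmx_antidiag k (A : 'M[K]_2) :
  A ord0 ord0 = 0 -> A ord_max ord_max = 0 ->
  forall i j, i != rev_ord j -> (A ^t k) i j = 0.
Proof.
move=> A00 A11; elim: k => [|k IH] i j; first by rewrite !ord1.
have [ek|k_gt0] := posnP k.
  subst k; rewrite ntensmx1 -val_eqE.
  by case: i => -[|[|//]] hi; case: j => -[|[|//]] hj //= _;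
    [rewrite -[RHS]A00|rewrite -[RHS]A11]; congr (A _ _); apply: val_inj.
have [i1 [i2 ei]] := bit_split i; have [j1 [j2 ej]] := bit_split j.
rewrite (ntensmxSr _ k_gt0 ei ej) => ne.
have [e2|/IH->] := eqVneq i2 (rev_ord j2); last by rewrite mulr0.
have {IH e2}e2 : (i2 + j2).+1 = (2 ^ k)%N.
  by move/(congr1 val): e2 => /=; have := ltn_ord j2; lia.
suff -> : A i1 j1 = 0 by rewrite mul0r.
(* The lower digits are complementary already, so the leading ones must agree, lest [i] be the full
   complement of [j]. *)
have : (i1 == j1 :> nat).
  apply: contraTT ne; rewrite -val_eqE /= ei ej expnS.
  case: i1 {ei} => -[|[|//]] h1; case: j1 {ej} => -[|[|//]] h2 //= _; rewrite negbK; lia.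
by case: i1 {ei ne} => -[|[|//]] h1; case: j1 {ej} => -[|[|//]] h2 //= _;
    [rewrite -[RHS]A00|rewrite -[RHS]A11]; congr (A _ _); apply: val_inj.
Qed.

Lemma ntensmx_delta0 k (i : 'I_(2 ^ k)) j :
  ((delta_mx ord0 ord0 : 'cV[K]_2) ^t k) i j = (i == 0%N :> nat)%:R.
Proof.
elim: k i j => [|k IH] i j; first by rewrite !mxE !ord1.
have [ek|k_gt0] := posnP k.
  subst k; rewrite ntensmx1 mxE; case: i => -[|[|//]] hi; by rewrite [j]ord1.
have [i1 [i2 ei]] := bit_split i.
(* [1 ^ k] does not reduce to 1 for a variable [k], so the column index is rebuilt from an explicit
   zero. *)
have h : (0 < 1 ^ k)%N by rewrite exp1n.
have ej : j = ((ord0 : 'I_1) * 1 ^ k + Ordinal h)%N :> nat.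
  by case: j => j hj /=; move: hj; rewrite exp1n; case: j.
rewrite (ntensmxSr _ k_gt0 ei ej) IH !mxE ei addn_eq0 muln_eq0.
rewrite (gtn_eqF (_ : 0 < 2 ^ k)%N) ?expn_gt0 // orbF andbT.
by rewrite -natrM mulnb.
Qed.

Lemma ntensmx_delta1 k (i : 'I_(2 ^ k)) j :
  ((delta_mx ord_max ord0 : 'cV[K]_2) ^t k) i j = (i.+1 == 2 ^ k)%N%:R.
Proof.
elim: k i j => [|k IH] i j; first by rewrite !mxE !ord1.
have [ek|k_gt0] := posnP k.
  subst k; rewrite ntensmx1 mxE; case: i => -[|[|//]] hi; by rewrite [j]ord1.
have [i1 [i2 ei]] := bit_split i.
have h : (0 < 1 ^ k)%N by rewrite exp1n.
have ej : j = ((ord0 : 'I_1) * 1 ^ k + Ordinal h)%N :> nat.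
  by case: j => j hj /=; move: hj; rewrite exp1n; case: j.
rewrite (ntensmxSr _ k_gt0 ei ej) IH !mxE ei -natrM mulnb andbT.
congr (_%:R); congr nat_of_bool; rewrite -val_eqE /=; have := ltn_ord i2; rewrite expnS.
by case: i1 {ei} => -[|[|//]] h1 /=; lia.
Qed.

End Generators.

(** * The Jones-Wenzl recursion *)

Section JonesWenzl.
Variable R : realType.

(** The binary words 0...0 and 1...1, the positions of v_1^{(x) k} and v_2^{(x) k}. *)
Definition is_end k (i : 'I_(2 ^ k)) := (i == 0%N :> nat) || (i.+1 == 2 ^ k)%N.

Definition end_proj k : tend R k := diag_mx (\row_i (is_end i)%:R).

(** Read in binary, 1 is the position of v_1 (x) v_2 and 2 that of v_2 (x) v_1. *)
Lemma coev_evE (r s : 'I_(2 * 2)) :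
  (coev R *m ev R) r s =
  ((r == 2%N :> nat)%:R - (r == 1%N :> nat)%:R) *
  ((s == 1%N :> nat)%:R - (s == 2%N :> nat)%:R).
Proof.
rewrite mxE big_ord1 !mxE.
case: r => -[|[|[|[|//]]]] hr; case: s => -[|[|[|[|//]]]] hs;
  rewrite -!val_eqE /= ?mulr1 ?mulr0 ?mul0r ?subr0 ?sub0r; by [].
Qed.

Lemma e1barE (r s : 'I_(2 * 2)) :
  (e1bar R) r s =
  - ((r == 2%N :> nat)%:R + (r == 1%N :> nat)%:R) *
  ((s == 1%N :> nat)%:R + (s == 2%N :> nat)%:R).
Proof.
rewrite mxE big_ord1 !mxE.
case: r => -[|[|[|[|//]]]] hr; case: s => -[|[|[|[|//]]]] hs;
  rewrite -!val_eqE /= ?mulr1 ?mulr0 ?mul0r ?subr0 ?sub0r ?addr0 ?add0r; by [].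
Qed.

(** [i %/ 4] collects the digits on which the identity acts, [i %% 4] the last two, on which the
    cup-cap acts. *)
Lemma cupcapE m (i j : 'I_(2 ^ m.+2)) :
  cupcap R m i j = (i %/ 4 == j %/ 4)%N%:R *
    ((i %% 4 == 2)%N%:R - (i %% 4 == 1)%N%:R) *
    ((j %% 4 == 1)%N%:R - (j %% 4 == 2)%N%:R).
Proof. by rewrite castmxE mxE coev_evE mxE -val_eqE /= mulrA. Qed.

Lemma tens_id_diag k (d : 'rV[R[i]]_(2 ^ k)) (e : 'rV[R[i]]_(2 ^ k.+1)) :
  (forall (i : 'I_(2 ^ k.+1)) (j : 'I_(2 ^ k)),
     j = (i %/ 2)%N :> nat -> e 0 i = d 0 j) ->
  tens_id (diag_mx d) = diag_mx e.
Proof.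
move=> ed; apply/matrixP => i j; rewrite castmxE !mxE -!val_eqE /=.
rewrite (ed i (mxtens_unindex (cast_ord (esym (esym (expnSr 2 k))) i)).1) //.
rewrite (_ : (i == j :> nat) = (i %/ 2 == j %/ 2) && (i %% 2 == j %% 2))%N; last lia.
by case: eqP => _; case: eqP => _; rewrite /= ?mulr1n ?mulr0n ?mulr1 ?mulr0 ?mul0r.
Qed.

(** For j >= 2, f_j (x) id selects the words whose first j digits agree, and e_j only links words
    ending in 01 or 10 with a common prefix. Among the selected words these are 0...01 and 1...10.
    Their prefixes differ, so no off-diagonal entry survives, while the diagonal entry -1 of e_j
    removes both words. *)
Lemma JW_end_proj k : (0 < k)%N -> JW R k = end_proj k.
Proof.
elim: k => // -[|[|m]] IH _.
- apply/matrixP => i j; rewrite !mxE /is_end.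
  by case: i => -[|[|//]] hi; rewrite /= ?expn1.
(* In degree 2 the half sum is -1 at the diagonal positions 01 and 10 and 0 elsewhere, as the
   off-diagonal entries of the two maps cancel. *)
- apply/matrixP => i j.
  rewrite [in LHS]mxE [in X in _ + X]mxE [in X in _ * X]mxE.
  rewrite coev_evE e1barE !mxE /is_end -val_eqE.
  case: i => -[|[|[|[|//]]]] hr; case: j => -[|[|[|[|//]]]] hs;
    rewrite /= ?mulr0n ?mulr1n ?subr0 ?sub0r ?addr0 ?add0r ?mulr0 ?mul0r ?mulr1
      ?mul1r ?addr0 //; by field.
have -> : JW R m.+3 = tens_id (JW R m.+2) +
    tens_id (JW R m.+2) *m cupcap R m.+1 *m tens_id (JW R m.+2) by [].
rewrite IH //.
pose d : 'rV[R[i]]_(2 ^ m.+3) :=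
  \row_i ((i %/ 2 == 0)%N || ((i %/ 2).+1 == 2 ^ m.+2)%N)%:R.
rewrite (@tens_id_diag _ _ d); last by move=> i j e; rewrite !mxE /is_end e.
apply/matrixP => i j.
rewrite mul_mx_diag mul_diag_mx !mxE cupcapE -val_eqE /= /is_end.
case: i => i hi; case: j => j hj /=; move: hi hj; rewrite !expnS.
have := expn_gt0 2 m => /=; move: (2 ^ m)%N => M M0 hi hj.
set qi := (_ || _); set qj := ((j %/ 2 == 0)%N || _); set ei := (_ || _).
have [ij|ij] := eqVneq i j.
  subst j; rewrite eqxx mul1r.
  have -> : ei = [&& qi, ~~ (i %% 4 == 1)%N & ~~ (i %% 4 == 2)%N].
    by rewrite /ei /qi; lia.
  have : ~~ ((i %% 4 == 1)%N && (i %% 4 == 2)%N) by lia.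
  rewrite (_ : qj = qi) //.
  by case: (_ == 1)%N; case: (_ == 2)%N; case: qi => //= _; ring.
(* Distinct selected words ending in 01 or 10 differ before their last two digits, since that prefix
   is nonempty. *)
have : ~~ [&& qi, qj, (i %/ 4 == j %/ 4)%N,
             (i %% 4 == 1)%N || (i %% 4 == 2)%N & (j %% 4 == 1)%N || (j %% 4 == 2)%N].
  by rewrite /qi /qj; lia.
rewrite !mulr0n add0r.
case: (_ == _)%N; last by rewrite !(mul0r, mulr0).
case: qi; last by rewrite !(mul0r, mulr0).
case: qj; last by rewrite !(mul0r, mulr0).
by do 4?[case: (_ %% _ == _)%N] => //= _; ring.
Qed.
End JonesWenzl.

(** * Complete reducibility *)

(** Finite dimension suffices: a subspace below every upper bound of the family grows by a member
    that it misses, and the bound [n] on its codimension drops each time. *)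
Lemma is_sum_of_exists (R : realType) k (P : {vspace tpow R k} -> Prop) :
  exists W, is_sum_of P W.
Proof.
suff H n (W : {vspace tpow R k}) : (\dim {:tpow R k} - \dim W <= n)%N ->
    (forall W', (forall U, P U -> (U <= W')%VS) -> (W <= W')%VS) ->
    exists W, is_sum_of P W.
  by apply: (H _ 0%VS (leqnn _)) => W' _; exact: sub0v.
elim: n W => [|n IH] W hn minW.
  exists W; split => // U _; have -> : W = fullv; last exact: subvf.
  by apply/eqP; rewrite eqEdim subvf -subn_eq0 -leqn0.
have [[U PU UW]|allW] := pselect (exists2 U, P U & ~~ (U <= W)%VS); last first.
  exists W; split => // U PU; apply/negPn/negP => UW.
  by apply: allW; exists U.
apply: (IH (U + W)%VS) => [|W' hW']; last by rewrite subv_add hW' ?minW.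
have ltW : (\dim W < \dim (U + W))%N.
  rewrite ltn_neqAle dimvS ?addvSr // andbT.
  rewrite (dimv_leqif_eq (addvSr U W)).
  by apply: contra UW => /eqP ->; exact: addvSl.
by rewrite leq_subLR (leq_trans _ (leq_add ltW (leqnn n))) // addSnnS -leq_subLR.
Qed.

(** * Stable and simple subspaces *)

Section Representations.
Variables (R : realType) (G : 'M[R[i]]_2 -> Prop).

Lemma stable_cap k (U W : {vspace tpow R k}) :
  stable G U -> stable G W -> stable G (U :&: W)%VS.
Proof.
move=> sU sW g Gg u /memv_capP[uU uW].
by rewrite memv_cap sU ?sW.
Qed.

Lemma stable_add k (U W : {vspace tpow R k}) :
  stable G U -> stable G W -> stable G (U + W)%VS.
Proof.
move=> sU sW g Gg _ /memv_addP[u uU [w wW ->]].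
by rewrite mulmxDr memv_add ?sU ?sW.
Qed.

Lemma stable_sum k (s : seq {vspace tpow R k}) :
  (forall U, U \in s -> stable G U) -> stable G (\sum_(U <- s) U)%VS.
Proof.
move=> sS; rewrite big_seq; apply: (big_ind (fun W => stable G W)).
- by move=> g _ u; rewrite memv0 => /eqP->; rewrite mulmx0 mem0v.
- exact: stable_add.
- exact: sS.
Qed.

Lemma stable_img k (f : tend R k) (U : {vspace tpow R k}) :
  equivariant G f -> stable G U ->
  stable G (linfun (mulmx f : tpow R k -> tpow R k) @: U)%VS.
Proof.
move=> ef sU g Gg _ /memv_imgP[u uU ->].
by rewrite lfunE /= mulmxA -ef // -mulmxA -[f *m _](lfunE (mulmx f)) memv_img ?sU.
Qed.

Lemma stable_ker k (f : tend R k) : equivariant G f ->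
  stable G (lker (linfun (mulmx f : tpow R k -> tpow R k))).
Proof.
move=> ef g Gg u; rewrite !memv_ker !lfunE /= => /eqP fu.
by rewrite mulmxA ef // -mulmxA fu mulmx0.
Qed.

Lemma simple_capP k (U W : {vspace tpow R k}) :
  simple_sub G U -> stable G W -> (U :&: W = 0)%VS \/ (U <= W)%VS.
Proof.
move=> [sU _ minU] sW.
have [|->|e] := minU (U :&: W)%VS (stable_cap sU sW); first exact: capvSl.
  by left.
by right; rewrite -e capvSr.
Qed.

Lemma simple_line k (u : tpow R k) :
  u != 0 -> stable G <[u]>%VS -> simple_sub G <[u]>%VS.
Proof.
move=> u0 su; split=> // [/eqP|W _ Wu].
  by rewrite -dimv_eq0 dim_vline u0.
have := dimvS Wu; rewrite dim_vline u0 leq_eqVlt ltnS leqn0 dimv_eq0.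
case/orP => /eqP; last by left.
move=> dW; right; apply/eqP; rewrite eqEdim Wu /= dim_vline u0.
by rewrite dW.
Qed.

Lemma rep_iso_refl k (U : {vspace tpow R k}) : rep_iso G U U.
Proof.
exists \1%VF; split=> [u v _ _|| g _ u _]; rewrite ?lfunE ?id_lfunE //.
by rewrite lim1g.
Qed.

(** Greedy choice: by simplicity each new [U] either meets the sum built so far trivially and is
    added, or lies inside it and is dropped. *)
Lemma simple_complement k (S : {vspace tpow R k}) l :
  stable G S -> (forall U, U \in l -> simple_sub G U) ->
  exists s, [/\ {subset s <= l}, directv (S + \sum_(U <- s) U) &
                (S + \sum_(U <- l) U)%VS = (S + \sum_(U <- s) U)%VS].
Proof.
move=> sS; elim: l => [|U l IH] sl.
  by exists [::]; rewrite directvE /= !big_nil addv0 addn0.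
have [W Wl|s [sub dir eq_s]] := IH; first by apply: sl; rewrite inE Wl orbT.
have sW : stable G (S + \sum_(U <- s) U)%VS.
  apply: stable_add => //; apply: stable_sum => W /sub Wl.
  by have [] := sl W; first by rewrite inE Wl orbT.
have UW : (S + \sum_(W <- U :: l) W = U + (S + \sum_(U <- s) U))%VS.
  by rewrite big_cons addvA (addvC S U) -addvA eq_s.
have [|cap0|leU] := @simple_capP _ U _ _ sW; first by apply: sl; rewrite mem_head.
  exists (U :: s); split.
  - move=> W; rewrite !inE => /orP[->//|/sub->]; exact: orbT.
  - move: dir; rewrite !directvE /= !big_cons => /eqP dir.
    by rewrite addvA (addvC S U) -addvA dimv_disjoint_sum // dir addnCA.
  - by rewrite UW big_cons addvA (addvC U S) -addvA.
exists s; split => //; first by move=> W /sub; rewrite inE orbC => ->.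
by rewrite UW; apply/addv_idPr.
Qed.

End Representations.

(** * Roots of unity on the circle *)

Section ComplexExponential.
Variable R : realType.
Implicit Types x t : R.

Lemma expiD x t : expi (x + t) = expi x * expi t.
Proof. by rewrite /expi cosD sinD; simpc; congr (_ +i* _); ring. Qed.

Lemma expi0 : expi (0 : R) = 1.
Proof. by rewrite /expi cos0 sin0. Qed.

Lemma expiN t : expi t * expi (- t) = 1.
Proof. by rewrite -expiD subrr expi0. Qed.

Lemma expiX t n : expi t ^+ n = expi (t *+ n).
Proof. by elim: n => [|n IH]; rewrite ?expi0 // exprS IH -expiD -mulrS. Qed.

(** The real part suffices: cos t = 1 - 2 sin^2 (t/2). *)
Lemma expi_eq1 t : expi t = 1 -> sin (t / 2) = 0.
Proof.
case=> c _; apply/eqP; rewrite -sqrf_eq0; apply/eqP.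
have := cos_mulr2n (t / 2); rewrite (_ : t / 2 *+ 2 = t); last by field.
by rewrite c cos2sin2 => e; lra.
Qed.

Lemma sin_eq0_nat x : 0 <= x -> sin x = 0 -> exists n : nat, x = pi *+ n.
Proof.
move=> x0 sx; have p0 := pi_gt0 R.
have q0 : 0 <= x / pi by rewrite divr_ge0 // ltW.
have /andP[le_n lt_n] := truncn_itv q0.
(* With [n] the integer part of [x / pi], the remainder [x - pi *+ n] is below pi. If positive it
   would have positive sine, yet its sine is that of [x] up to sign. *)
set n := Num.truncn _ in le_n lt_n; exists n.
move: le_n lt_n; rewrite ler_pdivlMr // ltr_pdivrMr // !mulr_natl mulrSr => le_n lt_n.
apply/eqP; rewrite eq_le le_n andbT leNgt; apply/negP => ltx.
have /sin_gt0_pi : 0 < x - pi *+ n < pi by apply/andP; split; lra.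
suff -> : sin (x - pi *+ n) = 0 by rewrite ltxx.
apply/eqP; move: sx => /eqP; rewrite -{1}(subrK (pi *+ n) x) (alternatingn (@sinDpi R)).
by rewrite mulf_eq0 signr_eq0.
Qed.

Lemma expi_irrational t n : irrational (t / pi) -> (0 < n)%N -> expi t ^+ n <> 1.
Proof.
move=> irr n0; rewrite expiX => /expi_eq1 s0; apply: irr.
have p0 : pi != 0 :> R by rewrite gt_eqF ?pi_gt0.
have n0' : n%:R != 0 :> R by rewrite pnatr_eq0 -lt0n.
(* [sin_eq0_nat] takes a nonnegative argument; the sign is restored by [s], which is 1 or -1
   below. *)
have [m e] : exists m, `|t *+ n / 2| = pi *+ m.
  apply: sin_eq0_nat; rewrite ?normr_ge0 //.
  by case: (ler0P (t *+ n / 2)) => _; rewrite ?sinN s0 ?oppr0.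
have tn (s : R) : t *+ n / 2 = s * (pi *+ m) -> t / pi = s * (m * 2)%:R / n%:R.
  rewrite -[t *+ n]mulr_natr -[pi *+ m]mulr_natr natrM => e'.
  have -> : t = s * (pi * m%:R) * 2 / n%:R by rewrite -e'; field.
  by move: pi p0 => p p0; field; rewrite n0' p0.
apply/rationalP.
case: (ler0P (t *+ n / 2)) e => _ e.
  exists (- (m * 2)%N%:Z), n; rewrite (tn (-1)); first by rewrite rmorphN /= mulN1r.
  by rewrite mulN1r -e opprK.
by exists (m * 2)%N%:Z, n; rewrite (tn 1) ?mul1r.
Qed.

(** Half the angle, m pi / (2 n), lies strictly between 0 and pi, where the sine is positive. *)
Lemma expi_pi_div n m : (0 < m < n.*2)%N -> expi (pi / n%:R : R) ^+ m <> 1.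
Proof.
move=> /andP[m0 mn]; rewrite expiX => /expi_eq1; apply/eqP; rewrite gt_eqF //.
have p0 := pi_gt0 R; have n0 : 0 < n%:R :> R by rewrite ltr0n; lia.
have m0' : 0 < m%:R :> R by rewrite ltr0n.
rewrite sin_gt0_pi // -[_ *+ m]mulr_natr; apply/andP; split.
  by rewrite !(divr_gt0, mulr_gt0).
rewrite ltr_pdivrMr // mulrAC ltr_pdivrMr // -mulrA ltr_pM2l //.
by rewrite -natrM ltr_nat; lia.
Qed.

End ComplexExponential.

(** * The action of the dicyclic groups *)

Local Notation "''b_' i" := (delta_mx i (ord0 : 'I_1))
  (at level 8, i at level 2, format "''b_' i").

Section DicyclicAction.
Variables (R : realType) (t : R).
Local Notation G := (dicyclic t).
Local Notation X k := (gen_x R ^t k).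
Local Notation A k := (gen_a t ^t k).

Lemma gen_x_sqr : gen_x R *m gen_x R = (-1)%:M.
Proof.
apply/matrixP => i j; rewrite !mxE !big_ord_recl big_ord0 !mxE.
case: i => -[|[|//]] hi; case: j => -[|[|//]] hj; rewrite -!val_eqE /=; ring.
Qed.

(** [invmx] is a true inverse only on units, so the [generatedV] cases below rest on this. *)
Lemma dicyclic_unit g : G g -> g \in unitmx.
Proof.
elim=> [|h [->|->]|h h' _ hu _ hu'|h _ hu].
- exact: unitmx1.
- suff /mulmx1_unit[] : gen_x R *m - gen_x R = 1%:M by [].
  by rewrite mulmxN gen_x_sqr raddfN opprK.
- rewrite unitmxE det_diag !big_ord_recl big_ord0 !mxE /= mulr1.
  by rewrite expiN unitr1.
- by rewrite unitmx_mul hu hu'.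
- by rewrite unitmx_inv.
Qed.

Lemma ntensmxV k (g : 'M[R[i]]_2) : g \in unitmx -> g ^t k *m invmx g ^t k = 1%:M.
Proof. by move=> gu; rewrite -ntensmxM mulmxV // ntensmx_scalar expr1n. Qed.

Lemma ntensVmx k (g : 'M[R[i]]_2) : g \in unitmx -> invmx g ^t k *m g ^t k = 1%:M.
Proof. by move=> gu; rewrite -ntensmxM mulVmx // ntensmx_scalar expr1n. Qed.

Lemma ntensmx_id k : (1%:M : 'M[R[i]]_2) ^t k = 1%:M.
Proof. by rewrite ntensmx_scalar expr1n. Qed.

Lemma dicyclic_equivariant k (f : tend R k) :
  f *m X k = X k *m f -> f *m A k = A k *m f -> equivariant G f.
Proof.
move=> fX fA g; elim=> [|h [->|->]|h h' _ eh _ eh'|h Gh eh] //.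
- by rewrite ntensmx_id mulmx1 mul1mx.
- by rewrite ntensmxM mulmxA eh -!mulmxA eh'.
- have hu := dicyclic_unit Gh.
  rewrite -[LHS]mul1mx -(ntensVmx k hu) -mulmxA (mulmxA (h ^t k)) -eh.
  by rewrite -(mulmxA f) ntensmxV // mulmx1.
Qed.

(** For inverses: a unit that maps [U] into itself maps it onto itself by dimension, so its inverse
    preserves [U] as well. *)
Lemma dicyclic_stable k (U : {vspace tpow R k}) :
  (forall u, u \in U -> X k *m u \in U) ->
  (forall u, u \in U -> A k *m u \in U) -> stable G U.
Proof.
move=> UX UA g; elim=> [|h [->|->]|h h' _ eh _ eh'|h Gh eh] // u uU.
- by rewrite ntensmx_id mul1mx.
- by rewrite ntensmxM -mulmxA eh ?eh'.
have hu := dicyclic_unit Gh.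
pose f := linfun (mulmx (h ^t k) : tpow R k -> tpow R k).
have fE v : f v = h ^t k *m v by rewrite lfunE.
have fU : (f @: U)%VS = U.
  apply/eqP; rewrite eqEdim limg_dim_eq ?leqnn ?andbT.
    by apply/subvP => _ /memv_imgP[v vU ->]; rewrite fE eh.
  apply/eqP; rewrite -subv0; apply/subvP => v; rewrite memv_cap memv_ker fE.
  by case/andP=> _ /eqP hv; rewrite memv0 -[v]mul1mx -(ntensVmx k hu) -mulmxA hv mulmx0.
move: uU; rewrite -{1}fU => /memv_imgP[v vU ->].
by rewrite fE mulmxA ntensVmx // mul1mx.
Qed.

Lemma gen_x_in : G (gen_x R). Proof. by apply: generated_in; left. Qed.
Lemma gen_a_in : G (gen_a t). Proof. by apply: generated_in; right. Qed.

(** * Eigenvalues of [a] and the flip by [x] *)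

Definition weight k (i : 'I_(2 ^ k)) : R[i] := A k i i.

(** The eigenvalue is z^(k - 2 c); multiplying by z^c keeps both exponents natural. *)
Lemma weightE k : exists c : 'I_(2 ^ k) -> nat,
  [/\ forall i, (c i <= k)%N,
      forall i, (c i == 0%N) = (i == 0%N :> nat),
      forall i, (c i == k) = (i.+1 == 2 ^ k)%N &
      forall i, weight i * expi t ^+ c i = expi t ^+ (k - c i)].
Proof.
have [c [c_le c0 ck cE]] := ntensmx_diag R[i] k.
exists c; split => // i.
rewrite /weight cE !mxE eqxx mulr1n -mulrA -exprMn.
by rewrite [expi (- t) * _]mulrC expiN expr1n mulr1.
Qed.

Lemma ntens_gen_a k : A k = diag_mx (\row_i weight i).
Proof.
have [c [_ _ _ cE]] := ntensmx_diag R[i] k.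
apply/matrixP => i j; rewrite /weight cE !mxE eqxx.
by case: eqP => [->|]; rewrite ?mulr1n ?mulr0n.
Qed.

Lemma expi_neq0 : expi t != 0.
Proof.
apply/eqP => e; have := expiN t.
by rewrite e mul0r => /esym/eqP; rewrite oner_eq0.
Qed.

Lemma weight_first k (i : 'I_(2 ^ k)) : i = 0%N :> nat -> weight i = expi t ^+ k.
Proof.
move=> i0; have [c [_ c0 _ /(_ i)]] := weightE k.
by have /eqP-> : c i == 0%N; rewrite ?c0 ?i0 // mulr1 subn0.
Qed.

Lemma weight_last k (i : 'I_(2 ^ k)) : i.+1 = (2 ^ k)%N -> weight i * expi t ^+ k = 1.
Proof.
move=> i0; have [c [_ _ ck /(_ i)]] := weightE k.
by have /eqP-> : c i == k; rewrite ?ck ?i0 // subnn.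
Qed.

(** The exponents k - 2 c with k <= K lie between -K and K, so two of them differ by at most 2 K. *)
Definition aperiodic K := forall m, (0 < m <= K.*2)%N -> expi t ^+ m <> 1.

Lemma aperiodic_inj K m n : aperiodic K -> (n <= m + K.*2)%N -> (m <= n)%N ->
  expi t ^+ m = expi t ^+ n -> m = n.
Proof.
move=> ap le_n le_m e; apply/eqP; rewrite eqn_leq le_m leqNgt; apply/negP => lt_mn.
apply: (ap (n - m)%N); first by lia.
apply: (mulIf (expf_neq0 m expi_neq0)).
by rewrite mul1r -exprD subnK.
Qed.

(** The hypothesis reads z^(K + c) = z^(k - c) with exponents at most 2 K apart. Hence K + c = k -
    c, and k <= K leaves only c = 0. *)
Lemma weight_eq_first k K (i : 'I_(2 ^ k)) : (k <= K)%N -> aperiodic K ->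
  weight i = expi t ^+ K -> K = k /\ i = 0%N :> nat.
Proof.
move=> kK ap wi; have [c [/(_ i) c_le /(_ i) c0 _ /(_ i)]] := weightE k.
rewrite wi -exprD => /esym e.
have E : (k - c i = K + c i)%N by apply: (aperiodic_inj ap) e; lia.
by split; [lia|apply/eqP; rewrite -c0; lia].
Qed.

Lemma weight_eq_last k K (i : 'I_(2 ^ k)) : (k <= K)%N -> aperiodic K ->
  weight i * expi t ^+ K = 1 -> K = k /\ i.+1 = (2 ^ k)%N.
Proof.
move=> kK ap wi; have [c [/(_ i) c_le _ /(_ i) ck /(_ i)]] := weightE k.
move/(congr1 ( *%R^~ (expi t ^+ K))); rewrite mulrAC wi mul1r -exprD => e.
have E : (c i = k - c i + K)%N by apply: (aperiodic_inj ap) e; lia.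
by split; [lia|apply/eqP; rewrite -ck; lia].
Qed.

Lemma mulA_delta k (i : 'I_(2 ^ k)) : A k *m 'b_i = weight i *: 'b_i.
Proof.
rewrite ntens_gen_a mul_diag_mx; apply/matrixP => j l; rewrite !mxE.
by case: eqP => [->|] //=; rewrite !mulr0.
Qed.

Definition flip_coef k (i : 'I_(2 ^ k)) : R[i] := X k (rev_ord i) i.

Lemma mulX_delta k (i : 'I_(2 ^ k)) : X k *m 'b_i = flip_coef i *: 'b_(rev_ord i).
Proof.
rewrite -colE; apply/matrixP => j l; rewrite !mxE ord1 eqxx andbT.
have [->|ne] := eqVneq; first by rewrite mulr1.
by rewrite mulr0 ntensmx_antidiag // !mxE.
Qed.

Lemma mulXX k : X k *m X k = ((-1) ^+ k)%:M.
Proof. by rewrite -ntensmxM gen_x_sqr ntensmx_scalar. Qed.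

(** [x] acts invertibly, its square being (-1)^k. *)
Lemma flip_coef_neq0 k (i : 'I_(2 ^ k)) : flip_coef i != 0.
Proof.
apply/eqP => x0; have := mulX_delta i; rewrite x0 scale0r.
move/(congr1 (mulmx (X k))); rewrite mulmx0 mulmxA mulXX mul_scalar_mx.
move/matrixP/(_ i ord0)/eqP; rewrite !mxE !eqxx /= mulr1.
by rewrite signr_eq0.
Qed.

Lemma delta_rev k (i : 'I_(2 ^ k)) :
  'b_(rev_ord i) = (flip_coef i)^-1 *: (X k *m 'b_i) :> tpow R k.
Proof. by rewrite mulX_delta scalerA mulVf ?flip_coef_neq0 ?scale1r. Qed.

(** Since [a] acts diagonally, an eigenvector is supported on the indices whose weight is its
    eigenvalue. *)
Lemma eigen_weight k (u : tpow R k) (mu : R[i]) (i : 'I_(2 ^ k)) :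
  A k *m u = mu *: u -> u i ord0 != 0 -> weight i = mu.
Proof.
rewrite ntens_gen_a mul_diag_mx => /matrixP/(_ i ord0); rewrite !mxE => h u0.
exact: (mulIf u0).
Qed.

Lemma cV_sum_delta k (u : tpow R k) : u = \sum_i u i ord0 *: 'b_i.
Proof.
apply/matrixP => i j; rewrite summxE ord1 (bigD1 i) //= !mxE !eqxx mulr1.
rewrite big1 ?addr0 // => l li; rewrite !mxE eqxx andbT.
by rewrite eq_sym (negPf li) mulr0.
Qed.

(** * Pairs of complementary basis vectors *)

Definition flip_pair k (i : 'I_(2 ^ k)) : {vspace tpow R k} :=
  (<['b_i]> + <['b_(rev_ord i)]>)%VS.

Lemma flip_pairP k (i : 'I_(2 ^ k)) u : u \in flip_pair i ->
  exists a b, u = a *: 'b_i + b *: 'b_(rev_ord i).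
Proof. by case/memv_addP=> _ /vlineP[a ->] [_ /vlineP[b ->] ->]; exists a, b. Qed.

Lemma mem_flip_pair k (i : 'I_(2 ^ k)) a b :
  a *: 'b_i + b *: 'b_(rev_ord i) \in flip_pair i.
Proof. by rewrite memv_add // memvZ // memv_line. Qed.

Lemma mem_flip_pair1 k (i : 'I_(2 ^ k)) : 'b_i \in flip_pair i.
Proof. by have := mem_flip_pair i 1 0; rewrite scale1r scale0r addr0. Qed.

Lemma mem_flip_pair2 k (i : 'I_(2 ^ k)) : 'b_(rev_ord i) \in flip_pair i.
Proof. by have := mem_flip_pair i 0 1; rewrite scale1r scale0r add0r. Qed.

Lemma flip_pair_rev k (i : 'I_(2 ^ k)) : flip_pair (rev_ord i) = flip_pair i.
Proof. by rewrite /flip_pair rev_ordK addvC. Qed.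

Lemma flip_pair_stable k (i : 'I_(2 ^ k)) : stable G (flip_pair i).
Proof.
apply: dicyclic_stable => _ /flip_pairP[a [b ->]]; rewrite mulmxDr -!scalemxAr.
  rewrite !mulX_delta rev_ordK memvD // !memvZ //.
    exact: mem_flip_pair2.
  exact: mem_flip_pair1.
by rewrite !mulA_delta !scalerA mem_flip_pair.
Qed.

Lemma flip_pair_sub k (i : 'I_(2 ^ k)) W :
  stable G W -> 'b_i \in W -> (flip_pair i <= W)%VS.
Proof.
move=> sW iW; rewrite subv_add -!memvE iW delta_rev memvZ //.
exact: sW gen_x_in _ _.
Qed.

Lemma delta_neq0 k (i : 'I_(2 ^ k)) : 'b_i != 0 :> tpow R k.
Proof.
apply/eqP => /matrixP/(_ i ord0)/eqP; rewrite !mxE !eqxx /=.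
by rewrite oner_eq0.
Qed.

Lemma flip_pair_simple k (i : 'I_(2 ^ k)) :
  weight i != weight (rev_ord i) -> simple_sub G (flip_pair i).
Proof.
move=> wi; split; first exact: flip_pair_stable.
  move=> U0; have := mem_flip_pair1 i; rewrite U0 memv0.
  by rewrite (negPf (delta_neq0 i)).
move=> W sW WU; have [->|W0] := eqVneq W 0%VS; [by left|right].
apply/eqP; rewrite eqEsubv WU /=.
have wW := memv_pick W; have := subvP WU _ wW.
case/flip_pairP => a [b wE]; rewrite wE in wW.
(* If [a] vanishes, [W] contains the reversed basis vector, which generates the same pair. *)
have [a0|a0] := eqVneq a 0.
  rewrite -flip_pair_rev flip_pair_sub //.
  have b0 : b != 0.
    apply: contraNneq W0 => b0; rewrite -vpick0 wE a0 b0.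
    by rewrite !scale0r addr0.
  by move: wW; rewrite a0 scale0r add0r rpredZeq (negPf b0).
apply: flip_pair_sub => //.
(* Subtracting the weight of the second basis vector kills its component and leaves a nonzero
   multiple of ['b_i], as the two weights differ. *)
have : A k *m (a *: 'b_i + b *: 'b_(rev_ord i)) -
       weight (rev_ord i) *: (a *: 'b_i + b *: 'b_(rev_ord i)) \in W.
  by rewrite memvB ?memvZ //; apply: sW gen_a_in _ _.
rewrite mulmxDr -!scalemxAr !mulA_delta scalerDr opprD !scalerA.
rewrite [b * _]mulrC addrACA subrr addr0 [a * _]mulrC -scalerBl -mulrBl.
by rewrite rpredZeq mulf_eq0 (negPf a0) orbF subr_eq0 (negPf wi).
Qed.
End DicyclicAction.

Arguments flip_coef {R k} i.
Arguments flip_pair {R k} i.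

(** * The leading summand *)

Section LeadingSummand.
Variables (R : realType) (t : R).
Local Notation G := (dicyclic t).
Local Notation X k := (gen_x R ^t k).
Local Notation A k := (gen_a t ^t k).

(** On such a pair the generator [a] is scalar, so every eigenvector of [x] spans a
    subrepresentation. As [x] squares to (-1)^k = c^2, the given vector has eigenvalue [c]. *)
Lemma flip_eigenline_simple k (i : 'I_(2 ^ k)) (c : R[i]) :
  (0 < k)%N -> weight t i = weight t (rev_ord i) -> c ^+ 2 = (-1) ^+ k ->
  simple_sub G <[X k *m 'b_i + c *: 'b_i]>%VS.
Proof.
move=> k0 wi c2; apply: simple_line.
  apply/eqP => /matrixP/(_ (rev_ord i) ord0)/eqP.
  rewrite mulX_delta !mxE !eqxx /= mulr1.
  (* A fixed point of the reversal would make 2^k = 2 i + 1 odd. *)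
  have -> : (rev_ord i == i) = false.
    apply/eqP => /(congr1 val) /= E; have := ltn_ord i.
    by have : ~~ odd (2 ^ k) by [rewrite oddX eqn0Ngt k0]; lia.
  by rewrite mulr0 addr0 (negPf (flip_coef_neq0 R i)).
apply: dicyclic_stable => _ /vlineP[a ->]; rewrite -scalemxAr memvZ //.
  rewrite mulmxDr mulmxA mulXX mul_scalar_mx -scalemxAr -c2 expr2 -scalerA.
  by rewrite -scalerDr addrC memvZ ?memv_line.
rewrite mulmxDr mulX_delta -!scalemxAr !mulA_delta -wi !scalerA.
by rewrite ![_ * weight t i]mulrC -!scalerA -scalerDr memvZ ?memv_line.
Qed.

Lemma flip_pair_semisimple k (i : 'I_(2 ^ k)) : (0 < k)%N ->
  exists l : seq {vspace tpow R k}, (forall U, U \in l -> simple_sub G U) /\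
    (\sum_(U <- l) U)%VS = flip_pair i.
Proof.
move=> k0; have [wi|wi] := eqVneq (weight t i) (weight t (rev_ord i)); last first.
  exists [:: flip_pair i]; rewrite big_seq1; split => // U.
  by rewrite inE => /eqP ->; exact: flip_pair_simple wi.
(* A square root of (-1)^k; the two eigenlines of [x] belong to [c] and [- c]. *)
pose c : R[i] := 'i%C ^+ k.
have c2 : c ^+ 2 = (-1) ^+ k by rewrite /c exprAC sqr_i.
have c0 : c != 0 by rewrite -sqrf_eq0 c2 signr_eq0.
pose u d := X k *m 'b_i + d *: 'b_i.
exists [:: <[u c]>%VS; <[u (- c)]>%VS]; split.
  move=> U; rewrite !inE => /orP[]/eqP ->; apply: flip_eigenline_simple => //.
  by rewrite sqrrN.
rewrite big_cons big_seq1; apply/eqP; rewrite eqEsubv; apply/andP; split.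
  have uP d : u d \in flip_pair i.
    by rewrite /u mulX_delta addrC mem_flip_pair.
  by rewrite subv_add -!memvE !uP.
set W := (_ + _)%VS.
have uW : u c \in W by rewrite -[u c]addr0 memv_add ?memv_line ?mem0v.
have vW : u (- c) \in W by rewrite -[u (- c)]add0r memv_add ?memv_line ?mem0v.
have two0 : 2 != 0 :> R[i] by rewrite pnatr_eq0.
rewrite subv_add -!memvE; apply/andP; split.
  suff -> : 'b_i = (2 * c)^-1 *: (u c - u (- c)) by rewrite memvZ ?memvB.
  rewrite /u opprD addrACA subrr add0r -scaleNr opprK -scalerDl scalerA.
  by rewrite -mulr2n -[c *+ 2]mulr_natl mulVf ?scale1r // mulf_neq0.
rewrite (delta_rev R i) memvZ //.
suff -> : X k *m 'b_i = 2^-1 *: (u c + u (- c)) by apply: memvZ; apply: memvD.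
rewrite /u addrACA scaleNr subrr addr0 -mulr2n -[_ *m _ *+ 2]scaler_nat scalerA.
by rewrite mulVf ?scale1r.
Qed.

(** * The diagonal projector and its kernel *)

Local Notation endmap k := (linfun (mulmx (end_proj R k) : tpow R k -> tpow R k)).

Lemma end_projE k n (u : 'M[R[i]]_(2 ^ k, n)) i j :
  (end_proj R k *m u) i j = (is_end i)%:R * u i j.
Proof. by rewrite mul_diag_mx !mxE. Qed.

Lemma is_end_rev k (i : 'I_(2 ^ k)) : is_end (rev_ord i) = is_end i.
Proof. by rewrite /is_end /=; have := ltn_ord i; lia. Qed.

(** [a] is diagonal too, and [x] reverses indices, which preserves being an end. *)
Lemma end_proj_equivariant k : equivariant G (end_proj R k).
Proof.
apply: dicyclic_equivariant; last first.
  by rewrite ntens_gen_a diag_mxC.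
apply/matrixP => i j; rewrite /end_proj mul_diag_mx mul_mx_diag !mxE.
have [->|ne] := eqVneq i (rev_ord j); first by rewrite is_end_rev mulrC.
by rewrite ntensmx_antidiag ?mulr0 ?mul0r // !mxE.
Qed.

Lemma end_proj_idem k : end_proj R k *m end_proj R k = end_proj R k.
Proof.
apply/matrixP => i j; rewrite end_projE !mxE.
by case: (is_end i); rewrite /= ?mul1r ?mul0r ?mul0rn.
Qed.

(** The kernel is spanned by the ['b_i] with [i] not an end; the pair of each such [i] stays in the
    kernel and is a sum of simples. *)
Lemma semisimple_kernel k : (0 < k)%N ->
  exists l : seq {vspace tpow R k},
    (forall U, U \in l -> simple_sub G U /\ (U <= lker (endmap k))%VS) /\
    (lker (endmap k) <= \sum_(U <- l) U)%VS.
Proof.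
move=> k0.
suff [l [lP lS]] : exists l : seq {vspace tpow R k},
    (forall U, U \in l -> simple_sub G U /\ (U <= lker (endmap k))%VS) /\
    forall i, i \in enum 'I_(2 ^ k) -> ~~ is_end i -> 'b_i \in (\sum_(U <- l) U)%VS.
  exists l; split => //; apply/subvP => u; rewrite memv_ker lfunE /= => /eqP pu.
  rewrite (cV_sum_delta u) rpred_sum // => i _.
  have [ei|ei] := boolP (is_end i); last by rewrite memvZ ?lS ?mem_enum.
  move/matrixP/(_ i ord0): pu; rewrite end_projE ei mul1r mxE => ->.
  by rewrite scale0r mem0v.
elim: (enum _) => [|i r [l [lP lS]]]; first by exists [::].
have [ei|ei] := boolP (is_end i).
  exists l; split => // j; rewrite inE => /orP[/eqP->|/lS//]; by rewrite ei.
have [l' [lP' lS']] := flip_pair_semisimple i k0.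
have sub : (flip_pair i <= lker (endmap k))%VS.
  have b0 j : ~~ is_end j -> 'b_j \in lker (endmap k).
    move=> ej; rewrite memv_ker lfunE /=; apply/eqP/matrixP => a b.
    rewrite end_projE !mxE; have [->|_] := eqVneq a j; last by rewrite mulr0.
    by rewrite (negPf ej) mul0r.
  by rewrite subv_add -!memvE !b0 ?is_end_rev.
exists (l' ++ l); split => [U|j].
  rewrite mem_cat => /orP[Ul|/lP//]; split; first exact: lP'.
  apply: subv_trans sub; rewrite -lS'.
  by rewrite (big_rem U) //= addvSl.
rewrite big_cat /= inE => /orP[/eqP-> _|jr ej].
  by apply: (subvP (addvSl _ _)); rewrite lS' mem_flip_pair1.
by apply: (subvP (addvSr _ _)); rewrite lS.
Qed.

(** * V_k as the outermost pair *)

Definition first_ord k : 'I_(2 ^ k) := Ordinal (expn_gt0 2 k).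

Lemma vec_tpow1 k : vec_tpow k (v1 R) = 'b_(first_ord k).
Proof.
apply/matrixP => i j; rewrite castmxE ntensmx_delta0 !mxE ord1 eqxx andbT.
by rewrite -val_eqE.
Qed.

Lemma vec_tpow2 k : vec_tpow k (v2 R) = 'b_(rev_ord (first_ord k)).
Proof.
apply/matrixP => i j; rewrite castmxE ntensmx_delta1 !mxE ord1 eqxx andbT.
rewrite -val_eqE /=; have hi := ltn_ord i.
by rewrite (_ : (i.+1 == 2 ^ k)%N = (i == 2 ^ k - 1 :> nat)%N); last lia.
Qed.

Lemma Vk_flip_pair k : Vk R k = flip_pair (first_ord k).
Proof. by rewrite /Vk span_cons span_seq1 vec_tpow1 vec_tpow2. Qed.

Lemma is_endP k (i : 'I_(2 ^ k)) :
  is_end i -> i = first_ord k \/ i = rev_ord (first_ord k).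
Proof.
case/orP => /eqP E; [left|right]; apply: val_inj => //=; lia.
Qed.

Lemma end_proj_in k (u : tpow R k) : end_proj R k *m u \in Vk R k.
Proof.
rewrite Vk_flip_pair (cV_sum_delta (_ *m u)) rpred_sum // => i _.
rewrite end_projE; have [|ei] := boolP (is_end i); last by rewrite mul0r scale0r mem0v.
by case/is_endP => ->; rewrite memvZ // ?mem_flip_pair1 ?mem_flip_pair2.
Qed.

Lemma end_proj_id k (u : tpow R k) : u \in Vk R k -> end_proj R k *m u = u.
Proof.
have b0 i : is_end i -> end_proj R k *m 'b_i = 'b_i.
  move=> ei; apply/matrixP => a b; rewrite end_projE !mxE.
  by have [->|_] := eqVneq a i; rewrite ?ei ?mul1r ?mulr0.
rewrite Vk_flip_pair => /flip_pairP[a [b ->]].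
by rewrite mulmxDr -!scalemxAr !b0 ?is_end_rev.
Qed.

Lemma Vk_stable k : stable G (Vk R k).
Proof. by rewrite Vk_flip_pair; exact: flip_pair_stable. Qed.

(** The preimage of v_1^{(x) k} serves: injectivity on [U] transports its eigenvalue equation
    back. *)
Lemma rep_iso_eigen j k (U : {vspace tpow R j}) :
  stable G U -> rep_iso G U (Vk R k) ->
  exists u, [/\ u \in U, u != 0 & A j *m u = expi t ^+ k *: u].
Proof.
move=> sU [h [injh hU hG]].
have : 'b_(first_ord k) \in (h @: U)%VS.
  by rewrite hU Vk_flip_pair mem_flip_pair1.
case/memv_imgP => u uU hu; exists u; split => //.
  apply/eqP => u0; move: hu; rewrite u0 linear0 => /eqP.
  by rewrite (negPf (delta_neq0 R (first_ord k))).
apply: injh; [exact: sU (gen_a_in t) _ uU|by rewrite memvZ|].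
by rewrite (hG _ (gen_a_in t)) // linearZ /= -hu mulA_delta weight_first.
Qed.

Lemma cV_neq0P k (u : tpow R k) : u != 0 -> exists i, u i ord0 != 0.
Proof.
move=> u0; have [//|nex] := pselect (exists i, u i ord0 != 0).
case/negP: u0; apply/eqP/matrixP => i j; rewrite ord1 mxE.
by apply/eqP/negPn/negP => ui; apply: nex; exists i.
Qed.

(** * V_k under aperiodicity *)

Section Aperiodic.
Variable k : nat.
Hypotheses (k_gt0 : (0 < k)%N) (ap : aperiodic t k).

(** Equality would give z^(2 k) = 1, the extreme case that aperiodicity excludes. *)
Lemma weight_first_rev :
  weight t (first_ord k) != weight t (rev_ord (first_ord k)).
Proof.
apply/eqP; rewrite weight_first // => E.
have : weight t (rev_ord (first_ord k)) * expi t ^+ k = 1.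
  by apply: weight_last => /=; have := expn_gt0 2 k; lia.
rewrite -E -exprD; apply: ap; lia.
Qed.

Lemma Vk_simple : simple_sub G (Vk R k).
Proof. by rewrite Vk_flip_pair; apply: flip_pair_simple; exact: weight_first_rev. Qed.

(** V_k carries the eigenvalue z^k, which [a] does not have on any smaller tensor power. *)
Lemma Vk_not_occurs j : (j < k)%N -> ~ occurs_in G j (Vk R k).
Proof.
move=> jk [U [[sU _ _] /(rep_iso_eigen sU)[u [_ /cV_neq0P[i ui] Au]]]].
have [E _] := weight_eq_first (ltnW jk) ap (eigen_weight Au ui).
by rewrite E ltnn in jk.
Qed.

Lemma eigen_first u :
  A k *m u = expi t ^+ k *: u -> u = u (first_ord k) ord0 *: 'b_(first_ord k).
Proof.
move=> Au; rewrite {1}(cV_sum_delta u) (bigD1 (first_ord k)) //= big1 ?addr0 //.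
move=> i ne; have [->|ui] := eqVneq (u i ord0) 0; first by rewrite scale0r.
have [_ i0] := weight_eq_first (leqnn k) ap (eigen_weight Au ui).
by case/eqP: ne; apply: val_inj.
Qed.

(** The z^k-eigenspace is the line of v_1^{(x) k}, so [U] contains that vector and with it V_k;
    simplicity of [U] gives equality. *)
Lemma simple_eigen_Vk (U : {vspace tpow R k}) u :
  simple_sub G U -> u \in U -> u != 0 -> A k *m u = expi t ^+ k *: u -> U = Vk R k.
Proof.
move=> [sU _ minU] uU u0 Au; have E := eigen_first Au.
move: uU u0; rewrite E rpredZeq scaler_eq0 negb_or => uU /andP[c0 _].
rewrite (negPf c0) /= in uU.
have VU : (Vk R k <= U)%VS by rewrite Vk_flip_pair; exact: flip_pair_sub sU uU.
have [sV V0 _] := Vk_simple.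
by case: (minU _ sV VU).
Qed.

Lemma rep_iso_Vk (U : {vspace tpow R k}) :
  simple_sub G U -> rep_iso G U (Vk R k) -> U = Vk R k.
Proof.
move=> sU isoU; have [sU' _ _] := sU.
have [u [uU u0 Au]] := rep_iso_eigen sU' isoU.
exact: simple_eigen_Vk sU uU u0 Au.
Qed.

(** Schur-type argument: if [U] meets the kernel trivially, the projector maps it isomorphically
    onto a nonzero stable subspace of the simple V_k, and no simple subspace but V_k is isomorphic
    to V_k. *)
Lemma simple_kernel (U : {vspace tpow R k}) :
  simple_sub G U -> (U <= lker (endmap k))%VS \/ U = Vk R k.
Proof.
move=> sU; have eq := @end_proj_equivariant k.
have [cap0|] := simple_capP sU (stable_ker eq); last by left.
right; apply: rep_iso_Vk => //; exists (endmap k); have [sU' U0 _] := sU; split.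
- move=> u v uU vU E; apply/eqP; rewrite -subr_eq0 -memv0 -cap0.
  by rewrite memv_cap memvB // memv_ker linearB /= E subrr.
- have sI : stable G (endmap k @: U)%VS by exact: stable_img.
  have [_ _ minV] := Vk_simple; case: (minV _ sI) => //.
    by apply/subvP => _ /memv_imgP[u _ ->]; rewrite lfunE end_proj_in.
  move=> /eqP; rewrite -dimv_eq0 limg_dim_eq // dimv_eq0 => /eqP.
  by move/U0.
- by move=> g Gg u _; rewrite !lfunE /= !mulmxA eq.
Qed.

Lemma Vk_not_sub_kernel (U : {vspace tpow R k}) :
  (U <= lker (endmap k))%VS -> U <> Vk R k.
Proof.
move=> UK UV; move: UK; rewrite UV => /subvP/(_ 'b_(first_ord k)).
have b0 : 'b_(first_ord k) \in Vk R k by rewrite Vk_flip_pair mem_flip_pair1.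
move=> /(_ b0); rewrite memv_ker lfunE /= end_proj_id //.
by rewrite (negPf (delta_neq0 R _)).
Qed.

Lemma Vk_multiplicity_one : multiplicity_one G (Vk R k).
Proof.
have [l [lP lS]] := semisimple_kernel k_gt0.
have [U /lP[]//|s [sl dir full]] := simple_complement (@Vk_stable k) (l := l).
exists s; split => // [U /sl/lP[sU UK]|].
  by split=> // /(rep_iso_Vk sU); exact: Vk_not_sub_kernel.
rewrite -full; apply/eqP; rewrite eqEsubv subvf /=; apply/subvP => u _.
(* Split [u] into its projection, in V_k, and the rest, in the kernel that the list covers. *)
rewrite -[u](subrK (end_proj R k *m u)) addrC memv_add ?end_proj_in //.
apply: (subvP lS); rewrite memv_ker lfunE /= mulmxBr mulmxA end_proj_idem.
by rewrite subrr.
Qed.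

Lemma Vk_leading : leading_summand G (Vk R k).
Proof.
by split; [exact: Vk_simple|exact: Vk_multiplicity_one|exact: Vk_not_occurs].
Qed.

Lemma end_proj_idempotent_onto : equiv_idempotent_onto G (Vk R k) (end_proj R k).
Proof.
split; [exact: end_proj_equivariant|exact: end_proj_idem|].
apply/eqP; rewrite eqEsubv; apply/andP; split; apply/subvP => u.
  by case/memv_imgP => v _ ->; rewrite lfunE end_proj_in.
move=> uV; apply/memv_imgP; exists u; rewrite ?memvf //.
by rewrite lfunE /= end_proj_id.
Qed.

(** [p] is the identity on V_k and commutes with [a]. For [j] not an end, [p] sends ['b_j] to a
    vector of V_k with eigenvalue [weight t j]; this differs from z^k and z^(-k), so the vector is
    zero. *)
Lemma idempotent_onto_Vk_unique p :
  equiv_idempotent_onto G (Vk R k) p -> p = end_proj R k.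
Proof.
move=> [eqp idp imp].
have pV u : p *m u \in Vk R k.
  by rewrite -imp -[p *m u](lfunE (mulmx p)) memv_img ?memvf.
have pid u : u \in Vk R k -> p *m u = u.
  by rewrite -imp => /memv_imgP[v _ ->]; rewrite lfunE /= mulmxA idp.
have pE i j : p i j = (p *m 'b_j) i ord0 by rewrite -colE [RHS]mxE.
apply/matrixP => i j; rewrite pE.
have [ej|ej] := boolP (is_end j).
  have -> : end_proj R k i j = (end_proj R k *m 'b_j) i ord0 by rewrite -colE [RHS]mxE.
  have bV : 'b_j \in Vk R k.
    rewrite Vk_flip_pair.
    by case/is_endP: ej => ->; rewrite ?mem_flip_pair1 ?mem_flip_pair2.
  by rewrite pid ?end_proj_id.
have Ap : A k *m (p *m 'b_j) = weight t j *: (p *m 'b_j).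
  by rewrite mulmxA -(eqp _ (gen_a_in t)) -mulmxA mulA_delta scalemxAr.
have -> : end_proj R k i j = 0.
  by rewrite !mxE; case: eqP => [->|]; rewrite ?mulr0n // (negPf ej).
apply/eqP/negPn/negP => pi0.
have ei : is_end i.
  apply: contraNT pi0 => ei; rewrite -(end_proj_id (pV _)) end_projE.
  by rewrite (negPf ei) mul0r.
have wij := eigen_weight Ap pi0.
move: ej; rewrite /is_end; case/orP: ei => /eqP ei.
  rewrite (weight_first t ei) in wij.
  by have [_ ->] := weight_eq_first (leqnn k) ap (esym wij).
have := weight_last t ei; rewrite wij => /(weight_eq_last (leqnn k) ap)[_ ->].
by rewrite eqxx orbT.
Qed.

(** A simple subspace isomorphic to [T] but outside the kernel would be V_k, and then so would [T].
    Conversely, the kernel is covered by simple subspaces not isomorphic to V_k, each inside its own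
    isotypic component. *)
Lemma end_proj_kernel :
  is_sum_of (fun C => exists T,
      [/\ simple_sub G T, ~ rep_iso G T (Vk R k) & is_isotypic G T C])
    (lker (endmap k)).
Proof.
split=> [C [T [sT nT [_ minC]]]|W hW].
  apply: minC => U [sU [h [injh hU hG]]].
  have [//|UV] := simple_kernel sU; case: nT.
  suff -> : T = Vk R k by exact: rep_iso_refl.
  have b0 : 'b_(first_ord k) \in U by rewrite UV Vk_flip_pair mem_flip_pair1.
  (* The isomorphism carries v_1^{(x) k} to a z^k-eigenvector in [T]. *)
  apply: (@simple_eigen_Vk _ (h 'b_(first_ord k))) => //.
  - by rewrite -hU memv_img.
  - apply: contraNneq (delta_neq0 R (first_ord k)) => hb0; apply/eqP.
    by apply: injh; rewrite ?mem0v // linear0.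
  - by rewrite -(hG _ (gen_a_in t)) // mulA_delta linearZ /= weight_first.
have [l [lP lS]] := semisimple_kernel k_gt0.
apply: subv_trans lS _; rewrite big_seq.
apply: (big_ind (fun S => (S <= W)%VS)) => [|S S' SW S'W|U /lP[sU UK]].
- exact: sub0v.
- by rewrite subv_add SW.
have [C CP] := @is_sum_of_exists R k (fun U' => simple_sub G U' /\ rep_iso G U' U).
have UC : (U <= C)%VS by apply: CP.1; split=> //; exact: rep_iso_refl.
apply: subv_trans UC _.
apply: hW; exists U; split=> //.
by move/(rep_iso_Vk sU); exact: Vk_not_sub_kernel.
Qed.

Lemma JW_leading_summand :
  leading_summand G (Vk R k) /\ projector_onto G (Vk R k) (JW R k).
Proof.
split; first exact: Vk_leading.
rewrite JW_end_proj //; split.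
- exact: end_proj_idempotent_onto.
- exact: idempotent_onto_Vk_unique.
- exact: end_proj_kernel.
Qed.
End Aperiodic.

End LeadingSummand.

Theorem proposition4p2p9 (R : realType) :
  (forall theta : R, irrational (theta / pi) ->
     forall k : nat, (1 <= k)%N ->
       leading_summand (Dic_inf theta) (Vk R k) /\
       projector_onto (Dic_inf theta) (Vk R k) (JW R k)) /\
  (forall n k : nat, (1 <= k < n)%N ->
     leading_summand (Dic_fin R n) (Vk R k) /\
     projector_onto (Dic_fin R n) (Vk R k) (JW R k)).
Proof.
split=> [theta irr k k0|n k /andP[k0 kn]].
  apply: JW_leading_summand => // m /andP[m0 _].
  exact: expi_irrational irr m0.
apply: JW_leading_summand => // m /andP[m0 mk].
(* From m <= 2 k and k < n follows m < 2 n. *)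
apply: expi_pi_div; rewrite m0 (leq_ltn_trans mk) //.
by rewrite ltn_double.
Qed.
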